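(* Let $N,m,r,l,k$ be positive integers with $l,k<N$. Assume the data $\mathcal F=\{f_1,\dots,f_m\}\subset\mathbb R^N$ is $(l,k)$-sparse and let $r>k$. Then almost all $A\in\mathbb R^{r\times N}$ (with respect to Lebesgue measure on $\mathbb R^{r\times N}$) are admissible for $\mathcal F$.
   Context: Data sets are finite indexed families of vectors (repetitions allowed); $d$ is Euclidean distance. A bundle in $\mathbb R^n$ is an indexed list $B=\{V_1,\dots,V_l\}$ of $l$ subspaces of $\mathbb R^n$ with $\dim V_i\le k$ for all $i$. For a data set $\mathcal G=\{g_1,\dots,g_m\}\subset\mathbb R^n$ put $e(\mathcal G,B)=\sum_{i=1}^m\min_{1\le j\le l}d^2(g_i,V_j)$ and $e_0(\mathcal G)=\inf_B e(\mathcal G,B)$ over all bundles in $\mathbb R^n$; a bundle attaining this infimum is optimal for $\mathcal G$. The data $\mathcal G$ is $(l,k)$-sparse if there is a bundle $B$ with $e(\mathcal G,B)=0$, i.e. $\mathcal G$ is contained in a union of $l$ subspaces of dimension at most $k$. A partition is a sequence $\mathbf S=\{S_1,\dots,S_l\}$ of pairwise disjoint, possibly empty, subsets of $\{1,\dots,m\}$ with union $\{1,\dots,m\}$. It is generated by $B=\{V_1,\dots,V_l\}$ (with respect to $\mathcal G$) if $j\in S_i$ implies $d(g_j,V_i)\le d(g_j,V_h)$ for all $h=1,\dots,l$. An optimal partition for $\mathcal G$ is a partition generated by an optimal bundle for $\mathcal G$. For $\mathcal F=\{f_1,\dots,f_m\}\subset\mathbb R^N$ $(l,k)$-sparse, a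 matrix $A\in\mathbb R^{r\times N}$ is admissible for $\mathcal F$ if for every optimal partition $\mathbf S=\{S_1,\dots,S_l\}$ for $\mathcal F'=\{Af_1,\dots,Af_m\}\subset\mathbb R^r$, the collection $B_{\mathbf S}=\{V_1,\dots,V_l\}$ with $V_i=\operatorname{span}\{f_j\}_{j\in S_i}$ is an optimal bundle for $\mathcal F$ (in particular $\dim V_i\le k$ for all $i$). *)

(* Defs.v *)
From HB Require Import structures.
From mathcomp Require Import all_boot all_order all_algebra.
From mathcomp Require Import all_classical all_reals all_analysis.

Set Implicit Arguments.
Unset Strict Implicit.
Unset Printing Implicit Defensive.

Import Order.TTheory GRing.Theory Num.Theory.
Import numFieldNormedType.Exports.

Local Open Scope classical_set_scope.
Local Open Scope ring_scope.

Section lebesgue_tuple.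
Context {R : realType}.
Local Notation T := (measurableTypeR R).

Definition cons_pair n (p : T * n.-tuple T) : n.+1.-tuple T :=
  [tuple of p.1 :: p.2].

Lemma measurable_cons_pair n : measurable_fun setT (@cons_pair n).
Proof. exact: (measurable_cons measurable_fst measurable_snd). Qed.

Definition lebesgue_step n
    (mu : {sigma_finite_measure set (n.-tuple T) -> \bar R}) :
    set (n.+1.-tuple T) -> \bar R :=
  pushforward (@lebesgue_measure R \x mu)%E (@cons_pair n).

Section step.
Variables (n : nat) (mu : {sigma_finite_measure set (n.-tuple T) -> \bar R}).
Local Notation lebesgue_step := (lebesgue_step mu).

HB.instance Definition _ := Measure.copy lebesgue_step
  (measure_function_pushforward__canonical__measure_function_Measure
     (@lebesgue_measure R \x mu)%E (@measurable_cons_pair n)).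

Let step_sigma_finite : sigma_finite setT lebesgue_step.
Proof.
have /sigma_finiteP[F [FT ndF Foo]] := sigma_finiteT (@lebesgue_measure R).
have /sigma_finiteP[G [GT ndG Goo]] := sigma_finiteT mu.
pose c (t : n.+1.-tuple T) : T * n.-tuple T :=
  (thead t, [tuple of behead t]).
have mc : measurable_fun setT c.
  apply/measurable_fun_pair; first exact: measurable_tnth.
  exact: measurable_behead.
have cK p : c (cons_pair p) = p.
  by case: p => x t; rewrite /c /cons_pair /=; congr pair; apply: val_inj.
exists (fun i => c @^-1` (F i `*` G i)).
  apply/esym/seteqP; split => // t _.
  have [i _ Fi] : (\bigcup_i F i) (c t).1 by rewrite -FT.
  have [j _ Gj] : (\bigcup_i G i) (c t).2 by rewrite -GT.
  exists (maxn i j) => //; split.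
    by move: Fi; exact/subsetPset/ndF/leq_maxl.
  by move: Gj; exact/subsetPset/ndG/leq_maxr.
move=> i; have [mFi Fi] := Foo i; have [mGi Gi] := Goo i; split.
  by rewrite -[X in measurable X]setTI; apply: mc => //; exact: measurableX.
rewrite /lebesgue_step /pushforward.
suff -> : @cons_pair n @^-1` (c @^-1` (F i `*` G i)) = F i `*` G i.
  by rewrite /= product_measure1E// lte_mul_pinfty// ge0_fin_numE.
by rewrite -comp_preimage (_ : c \o _ = id)//; apply/funext => p; exact: cK.
Qed.

HB.instance Definition _ := Measure_isSigmaFinite.Build _ _ _ lebesgue_step
  step_sigma_finite.

End step.

(* The n-fold product of the Lebesgue measure on the line: the unit mass at the
   only point of R^0, and R^(n+1) = R x R^n. *)
Fixpoint lebesgue_tuple n : {sigma_finite_measure set (n.-tuple T) -> \bar R} :=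
  match n with
  | 0%N => @dirac _ (0.-tuple T) [tuple] R
  | p.+1 => lebesgue_step (lebesgue_tuple p)
  end.

Lemma lebesgue_tuple_box n (A : 'I_n -> set T) :
  (forall i, measurable (A i)) ->
  lebesgue_tuple n [set t | forall i, A i (tnth t i)] =
  (\prod_(i < n) lebesgue_measure (A i))%E.
Proof.
elim: n A => [|n IH] A mA.
  rewrite big_ord0 /= /dirac indicE mem_set//=; first by case.
rewrite big_ord_recl -IH; last by move=> i; exact: mA.
rewrite [LHS]/= /lebesgue_step /pushforward.
have mB : measurable [set t : n.-tuple T | forall i, A (lift ord0 i) (tnth t i)].
  rewrite (_ : mkset _ = \bigcap_(i in [set: 'I_n])
      (fun t : n.-tuple T => tnth t i) @^-1` A (lift ord0 i)).
    apply: fin_bigcap_measurable => // i _; rewrite -[X in measurable X]setTI.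
    exact: measurable_tnth.
  by apply/seteqP; split => [t tA i _|t tA i]; exact: tA.
rewrite -product_measure1E//; congr (_ _).
apply/seteqP; split => [[x t] /= tA|[x t] [/= Ax At] i].
  split; first by have := tA ord0.
  by move=> i; have := tA (lift ord0 i); rewrite tnthS.
by case: (unliftP ord0 i) => [j ->|->]; [rewrite tnthS; exact: At|].
Qed.

End lebesgue_tuple.

Definition mx_of_tuple {R : realType} r N
    (t : (r * N).-tuple (measurableTypeR R)) : 'M[R]_(r, N) :=
  \matrix_(i, j) tnth t (mxvec_index i j).

(* The sigma-algebra and the measure of R^(r * N), transported to the matrices
   along the bijection mx_of_tuple. *)
Section measurable_matrix.
Context {R : realType} {r N : nat}.

Definition measurable_mx : set (set 'M[R]_(r, N)) :=
  [set X | measurable (@mx_of_tuple R r N @^-1` X)].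

Let measurable_mx0 : measurable_mx set0.
Proof. by rewrite /measurable_mx /= preimage_set0. Qed.

Let measurable_mxC X : measurable_mx X -> measurable_mx (~` X).
Proof. by rewrite /measurable_mx /= preimage_setC; exact: measurableC. Qed.

Let measurable_mx_bigcup (F : (set 'M[R]_(r, N))^nat) :
  (forall i, measurable_mx (F i)) -> measurable_mx (\bigcup_i F i).
Proof.
by move=> mF; rewrite /measurable_mx /= preimage_bigcup; exact: bigcupT_measurable.
Qed.

HB.instance Definition _ := @isMeasurable.Build default_measure_display
  'M[R]_(r, N) measurable_mx measurable_mx0 measurable_mxC measurable_mx_bigcup.

End measurable_matrix.

Section lebesgue_matrix.
Variables (R : realType) (r N : nat).

Lemma measurable_mx_of_tuple : measurable_fun setT (@mx_of_tuple R r N).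
Proof. by move=> _ X mX; rewrite setTI. Qed.

Definition lebesgue_mx : set 'M[R]_(r, N) -> \bar R :=
  pushforward (lebesgue_tuple (r * N)) (@mx_of_tuple R r N).

HB.instance Definition _ := Measure.copy lebesgue_mx
  (measure_function_pushforward__canonical__measure_function_Measure
     (lebesgue_tuple (r * N)) measurable_mx_of_tuple).

End lebesgue_matrix.
Arguments lebesgue_mx : clear implicits.

Section bundles.
Context {R : realType}.

Definition euclidean_norm n (x : 'cV[R]_n) : R :=
  Num.sqrt (\sum_i x i ord0 ^+ 2).

Definition dist_to n (g : 'cV[R]_n) (V : {vspace 'cV[R]_n}) : R :=
  inf [set euclidean_norm (g - v) | v in [set v | v \in V]].

Definition is_bundle n l (k : nat) (B : 'I_l -> {vspace 'cV[R]_n}) : Prop :=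
  forall i, (\dim (B i) <= k)%N.

(* The infimum over j is a minimum, since 'I_l is finite; it is only used for
   l > 0. *)
Definition bundle_error n m l
    (G : 'I_m -> 'cV[R]_n) (B : 'I_l -> {vspace 'cV[R]_n}) : R :=
  \sum_i inf [set dist_to (G i) (B j) ^+ 2 | j in [set: 'I_l]].

Definition min_error n m (l k : nat) (G : 'I_m -> 'cV[R]_n) : R :=
  inf [set bundle_error G B | B in [set B : 'I_l -> _ | is_bundle k B]].

Definition optimal_bundle n m l (k : nat)
    (G : 'I_m -> 'cV[R]_n) (B : 'I_l -> {vspace 'cV[R]_n}) : Prop :=
  is_bundle k B /\ bundle_error G B = min_error l k G.

Definition sparse n m (l k : nat) (G : 'I_m -> 'cV[R]_n) : Prop :=
  exists B : 'I_l -> {vspace 'cV[R]_n}, is_bundle k B /\ bundle_error G B = 0.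

(* Unlike finset.partition, the blocks are indexed and may be empty. *)
Definition is_partition m l (S : 'I_l -> {set 'I_m}) : Prop :=
  (forall i h, i != h -> (S i :&: S h)%SET = finset.set0) /\
  (\bigcup_i S i)%SET = [set: 'I_m]%SET.

Definition generated_by n m l (G : 'I_m -> 'cV[R]_n)
    (B : 'I_l -> {vspace 'cV[R]_n}) (S : 'I_l -> {set 'I_m}) : Prop :=
  forall i j, j \in S i -> forall h, dist_to (G j) (B i) <= dist_to (G j) (B h).

Definition optimal_partition n m l (k : nat)
    (G : 'I_m -> 'cV[R]_n) (S : 'I_l -> {set 'I_m}) : Prop :=
  is_partition S /\ exists2 B, optimal_bundle k G B & generated_by G B S.

Definition span_bundle n m l (F : 'I_m -> 'cV[R]_n) (S : 'I_l -> {set 'I_m}) :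
    'I_l -> {vspace 'cV[R]_n} :=
  fun i => <<[seq F j | j in S i]>>%VS.

Definition admissible N m r (l k : nat)
    (F : 'I_m -> 'cV[R]_N) (A : 'M[R]_(r, N)) : Prop :=
  forall S : 'I_l -> {set 'I_m},
    optimal_partition k (fun j => A *m F j) S ->
    optimal_bundle k F (span_bundle F S).

End bundles.

(* Main.v *)
(* The bundle error of sparse data is 0, so an optimal partition of A F groups
   vectors A f_j lying in a common subspace of dimension at most k. It therefore
   suffices that, for each set S of indices with dim span(f_j)_(j in S) > k, the
   images A f_j, j in S, also span more than k dimensions. Since r > k, this holds
   as soon as one (k+1)-minor is nonzero: a polynomial condition on A, satisfied
   by some A, hence by almost all A. *)

Require Import Defs.
From mathcomp Require Import all_boot all_order all_algebra.
From mathcomp Require Import finmap all_classical all_reals all_analysis.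
From mathcomp Require Import lra.

Set Implicit Arguments.
Unset Strict Implicit.
Unset Printing Implicit Defensive.

Import Order.TTheory GRing.Theory Num.Theory.

Local Open Scope classical_set_scope.
Local Open Scope ring_scope.

(** * Zero sets of polynomial functions *)

Lemma finite_roots (R : idomainType) (p : {poly R}) :
  p != 0 -> finite_set [set x | root p x].
Proof.
move=> p0; apply: contrapT => /(@infinite_set_fset _ _ (size p))[B BA].
rewrite leqNgt => /negP; apply; apply: max_poly_roots (fset_uniq B) => //.
by apply/allP => x xB; exact: BA.
Qed.

(* If f (a0, a) != 0, then f (x, a) != 0 for all but finitely many x; for those x
   the slice f (x, _) is not identically zero, and its zero set is null by
   induction. *)
Lemma lebesgue_tuple_zero_set (R : realType) n
    (f : n.-tuple (measurableTypeR R) -> R) :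
  measurable_fun setT f ->
  (forall c d : 'I_n -> R, exists p : {poly R}, forall x,
    f [tuple c i + x * d i | i < n] = p.[x]) ->
  (exists a, f a != 0) ->
  lebesgue_tuple n (f @^-1` [set 0]) = 0%E.
Proof.
elim: n f => [|n IH] f mf pf [a].
  move=> fa; rewrite /= /dirac indicE memNset//= => f0; move/eqP: fa; apply.
  by rewrite (tuple0 a) -(tuple0 [tuple]).
case/tupleP: a => a0 a fa.
have mfc : measurable_fun setT (f \o @cons_pair R n).
  by apply: measurableT_comp => //; exact: measurable_cons_pair.
set A := (f \o @cons_pair R n) @^-1` [set 0].
have mA : measurable A.
  by rewrite -[X in measurable X]setTI; apply: mfc.
rewrite /= /lebesgue_step /pushforward -/A /product_measure1.
(* Moving only the first coordinate is moving along a line, so [pf] yields a polynomial. *)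
have [p pE] : exists p : {poly R}, forall x : R,
    f (cons_pair (x, a)) = p.[x].
  have [p pE] := pf (fun i => if i == ord0 then 0 else tnth [tuple of a0 :: a] i)
                    (fun i => if i == ord0 then 1 else 0).
  exists p => x; rewrite -pE; congr f; apply: eq_from_tnth => i.
  rewrite tnth_mktuple; case: (unliftP ord0 i) => [j|] ->.
    by rewrite /= !tnthS mulr0 addr0.
  by rewrite /= !tnth0 mulr1 add0r.
have p0 : p != 0.
  apply: contra_neq fa => p0; have := pE a0; rewrite p0 horner0 => <-.
  by congr f; apply: val_inj.
pose N : set R := [set x | root p x].
have finN : finite_set N by exact: (finite_roots p0).
have mN : measurable (N : set (measurableTypeR R)).
  apply: countable_measurable (finite_set_countable finN).
  exact: measurable_set1.
rewrite (ge0_negligible_integral mN)//; last first.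
- exact: countable_lebesgue_measure0 (finite_set_countable finN).
- exact: measurable_fun_xsection.
apply: integral0_eq => x [_ /= Nx].
rewrite xsectionE; apply: (IH (fun t => f (cons_pair (x, t)))).
- by apply: (measurableT_comp mfc); exact: pair1_measurable.
(* A line in the slice is a line of the whole space: the first coordinate starts at [x] and has
   direction 0. *)
- move=> c d; pose ext y (e : 'I_n -> R) (i : 'I_n.+1) :=
    if unlift ord0 i is Some j then e j else y.
  have [q qE] := pf (ext x c) (ext 0 d); exists q => y; rewrite -qE.
  congr f; apply: eq_from_tnth => i; rewrite tnth_mktuple /ext.
  case: (unliftP ord0 i) => [j|] ->; first by rewrite tnthS tnth_mktuple.
  by rewrite mulr0 addr0 /= tnth0.
- exists a; rewrite pE; exact/negP.
Qed.

(** Evaluation at [x] is a ring morphism, so it commutes with the determinant of the matrix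
    [C + 'X *: D] of polynomials. *)
Lemma horner_det_line (R : comNzRingType) n (C D : 'M[R]_n) :
  exists p : {poly R}, forall x, \det (C + x *: D) = p.[x].
Proof.
exists (\det (map_mx polyC C + 'X *: map_mx polyC D)) => x.
rewrite -[RHS]/(horner_eval x _) -det_map_mx; congr (\det _).
by apply/matrixP => i j; rewrite !mxE /= horner_evalE !hornerE.
Qed.

Lemma measurable_det_mx_of_tuple (R : realType) n r N
    (P : 'M[R]_(n, r)) (Q : 'M[R]_(N, n)) :
  measurable_fun setT (fun t : (r * N).-tuple (measurableTypeR R) =>
    \det (P *m mx_of_tuple t *m Q)).
Proof.
apply: measurable_sum => s; apply: measurable_realfun.measurable_funM => //.
apply: measurable_prod => i _.
under eq_fun do rewrite mxE; apply: measurable_sum => b.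
apply: measurable_realfun.measurable_funM => //.
under eq_fun do rewrite mxE; apply: measurable_sum => a.
apply: measurable_realfun.measurable_funM => //.
by under eq_fun do rewrite mxE; exact: measurable_tnth.
Qed.

(** * Almost all matrices preserve linear independence *)

Lemma ae_det_neq0 (R : realType) n r N (P : 'M[R]_(n, r)) (Q : 'M[R]_(N, n)) :
  row_free P -> row_full Q ->
  {ae lebesgue_mx R r N, forall A : 'M[R]_(r, N), \det (P *m A *m Q) != 0}.
Proof.
move=> /row_freeP[P' PP'] /row_fullP[Q' Q'Q].
have mdet := measurable_det_mx_of_tuple P Q.
exists [set A | \det (P *m A *m Q) = 0]; split.
- by have := mdet measurableT _ (measurable_set1 0); rewrite setTI.
- apply: (lebesgue_tuple_zero_set mdet) => [c d|].
    have [p pE] := horner_det_line (P *m mx_of_tuple (mktuple c) *m Q)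
                                   (P *m mx_of_tuple (mktuple d) *m Q).
    exists p => x; rewrite -pE scalemxAl scalemxAr -mulmxDl -mulmxDr.
    congr (\det (_ *m _ *m _)); apply/matrixP => i j.
    by rewrite !mxE !tnth_mktuple.
  (* The one-sided inverses of [P] and [Q] give a matrix at which the determinant is 1. *)
  exists [tuple mxvec (P' *m Q') ord0 i | i < r * N].
  rewrite (_ : mx_of_tuple _ = P' *m Q').
    by rewrite mulmxA PP' mul1mx Q'Q det1 oner_eq0.
  by apply/matrixP => i j; rewrite mxE tnth_mktuple mxvecE.
- by move=> A /negP; rewrite negbK => /eqP.
Qed.

(** With the vectors as columns of [Q] and [pid_mx n] selecting the first [n] rows, a nonzero
    determinant of these rows of [A *m Q] makes its columns independent. *)
Lemma ae_free_mulmx (R : realType) n r N (X : n.-tuple 'cV[R]_N) :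
  (n <= r)%N -> free X ->
  {ae lebesgue_mx R r N, forall A : 'M[R]_(r, N),
    free [tuple A *m tnth X i | i < n]}.
Proof.
move=> le_nr /freeP freeX.
pose Q : 'M[R]_(N, n) := \matrix_(a, i) tnth X i a ord0.
have QE (c : 'I_n -> R) : Q *m (\col_i c i) = \sum_i c i *: tnth X i.
  apply/colP => a; rewrite mxE summxE; apply: eq_bigr => i _.
  by rewrite !mxE mulrC.
have Qfull : row_full Q.
  rewrite /row_full -mxrank_tr -/(row_free Q^T); apply: inj_row_free => v vQ0.
  apply/rowP => i.
  have : Q *m (\col_j v ord0 j) = 0.
    apply: trmx_inj; rewrite trmx_mul trmx0 -[RHS]vQ0; congr (_ *m _).
    by apply/rowP => j; rewrite !mxE.
  rewrite QE => v0; rewrite mxE; apply: (freeX (v ord0)).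
  by rewrite -[RHS]v0; apply: eq_bigr => j _; rewrite (tnth_nth 0).
have Pfree : row_free (pid_mx n : 'M[R]_(n, r)).
  by rewrite /row_free rank_pid_mx.
apply: filterS (ae_det_neq0 Pfree Qfull) => A; rewrite -unitfE -unitmxE => uA.
apply/freeP => c c0 i.
have : pid_mx n *m A *m Q *m (\col_j c j) = 0 :> 'cV_n.
  rewrite -!mulmxA QE mulmx_sumr (_ : \sum_i _ = 0) ?mulmx0// -[RHS]c0.
  by apply: eq_bigr => j _; rewrite -(tnth_nth 0) tnth_mktuple scalemxAr.
by move=> /(canRL (mulKmx uA)) /colP/(_ i); rewrite mulmx0 !mxE.
Qed.

(** Since [k < r], almost every [A] keeps [k.+1] basis vectors of [U] independent, and [W] contains
    their images. The null set does not depend on [W], so [W] may be chosen after [A]. *)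
Lemma ae_dim_mulmx (R : realType) k r N (U : {vspace 'cV[R]_N}) :
  (k < r)%N -> (k < \dim U)%N ->
  {ae lebesgue_mx R r N, forall A : 'M[R]_(r, N), forall W : {vspace 'cV[R]_r},
    (forall u, u \in U -> A *m u \in W) -> (k < \dim W)%N}.
Proof.
move=> lt_kr lt_kU.
have szX : size (take k.+1 (vbasis U)) == k.+1.
  by rewrite size_takel// size_tuple.
pose X := Tuple szX.
have freeX : free X.
  apply: (@catl_free _ _ (drop k.+1 (vbasis U))); rewrite cat_take_drop.
  exact: basis_free (vbasisP U).
apply: filterS (ae_free_mulmx lt_kr freeX) => A /eqP.
rewrite size_tuple => {1}<- W UW; apply/dimvS/span_subvP => _ /tnthP[i ->].
rewrite tnth_mktuple; apply: UW.
by apply: vbasis_mem; apply: mem_take (mem_tnth i X).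
Qed.


(** * Distance to a subspace *)

Lemma ler_abs_euclidean_norm (R : realType) n (x : 'cV[R]_n) i :
  `|x i ord0| <= euclidean_norm x.
Proof.
rewrite /euclidean_norm -sqrtr_sqr ler_wsqrtr// (bigD1 i)//= lerDl.
by apply: sumr_ge0 => j _; exact: sqr_ge0.
Qed.

Lemma euclidean_norm0 (R : realType) n : euclidean_norm (0 : 'cV[R]_n) = 0.
Proof.
rewrite /euclidean_norm big1 ?sqrtr0// => i _.
by rewrite mxE expr0n.
Qed.

Lemma dist_to_ge0 (R : realType) n (g : 'cV[R]_n) V : 0 <= dist_to g V.
Proof.
apply: lb_le_inf => [|_ [v _ <-]]; last exact: sqrtr_ge0.
by exists (euclidean_norm (g - 0)); exists 0 => //=; exact: mem0v.
Qed.

(* The converse direction is the closedness of V: a coordinate c of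
   h = 1 - projv V with h g c != 0 vanishes on V and is Lipschitz, so
   g cannot be approached from V. *)
Lemma dist_to_eq0 (R : realType) n (g : 'cV[R]_n) V :
  dist_to g V = 0 <-> g \in V.
Proof.
split=> [d0|gV]; last first.
  apply/eqP; rewrite eq_le dist_to_ge0 andbT; apply: ge_inf.
    by exists 0 => _ [v _ <-]; exact: sqrtr_ge0.
  by exists g => //; rewrite subrr euclidean_norm0.
pose h : 'End('cV[R]_n) := (\1 - projv V)%VF.
have hV v : v \in V -> h v = 0.
  by move=> vV; rewrite add_lfunE opp_lfunE id_lfunE projv_id// subrr.
have [hg0|] := eqVneq (h g) 0.
  move: hg0; rewrite add_lfunE opp_lfunE id_lfunE => /subr0_eq ->.
  exact: memv_proj.
case/cV0Pn => c hgc.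
pose K := \sum_i `|h (delta_mx i ord0) c ord0|.
have K0 : 0 <= K by exact: sumr_ge0.
have hK y : `|h y c ord0| <= K * euclidean_norm y.
  rewrite [in h y](matrix_sum_delta y) linear_sum summxE mulr_suml.
  apply: le_trans (ler_norm_sum _ _ _) _; apply: ler_sum => i _.
  rewrite big_ord1 linearZ mxE normrM mulrC.
  by rewrite ler_wpM2l// ler_abs_euclidean_norm.
(* Dividing by [K + 1] needs only [0 <= K]. *)
have dlt : dist_to g V < `|h g c ord0| / (K + 1).
  by rewrite d0 divr_gt0 ?normr_gt0//; lra.
have [|_ [v /= vV <-]] := inf_lt _ dlt.
  by exists (euclidean_norm (g - 0)); exists 0 => //=; exact: mem0v.
rewrite ltr_pdivlMr; last lra.
have := hK (g - v); rewrite raddfB /= (hV v)// subr0.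
have := sqrtr_ge0 (\sum_i (g - v) i ord0 ^+ 2); rewrite -/(euclidean_norm _); lra.
Qed.

(** * Bundle errors and sparse data *)

Lemma inf_sqr_dist_to_ge0 (R : realType) n l (g : 'cV[R]_n)
    (B : 'I_l -> {vspace 'cV[R]_n}) :
  0 <= inf [set dist_to g (B j) ^+ 2 | j in [set: 'I_l]].
Proof.
(* For [l = 0] the set is empty and its [inf] is 0 by default. *)
have [->|/set0P S0] := eqVneq [set dist_to g (B j) ^+ 2 | j in [set: 'I_l]] set0.
  by rewrite inf0.
by apply: lb_le_inf => // _ [j _ <-]; exact: sqr_ge0.
Qed.

Lemma bundle_error_ge0 (R : realType) n m l (G : 'I_m -> 'cV[R]_n)
    (B : 'I_l -> {vspace 'cV[R]_n}) : 0 <= bundle_error G B.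
Proof. by apply: sumr_ge0 => j _; exact: inf_sqr_dist_to_ge0. Qed.

(** Each term of a vanishing sum of nonnegative terms is 0, and for [0 < l] the infimum in it is
    attained. For [l = 0] the error would be 0 by default. *)
Lemma bundle_error_eq0 (R : realType) n m l (G : 'I_m -> 'cV[R]_n)
    (B : 'I_l -> {vspace 'cV[R]_n}) : (0 < l)%N ->
  bundle_error G B = 0 <-> forall j, exists i, G j \in B i.
Proof.
case: l B => // l B _; split=> [/eqP|GB].
  rewrite psumr_eq0 => [/allP G0 j|j _]; last exact: inf_sqr_dist_to_ge0.
  have /eqP inf0 := G0 j (mem_index_enum j).
  have [i _ imin] := @arg_minP _ _ _ ord0 xpredT
    (fun i => dist_to (G j) (B i) ^+ 2) isT.
  exists i; apply/dist_to_eq0/eqP; rewrite -sqrf_eq0 eq_le sqr_ge0 andbT -inf0.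
  apply: lb_le_inf => [|_ [h _ <-]]; last exact: imin.
  by exists (dist_to (G j) (B ord0) ^+ 2); exists ord0.
apply: big1 => j _; apply/eqP; rewrite eq_le inf_sqr_dist_to_ge0 andbT.
have [i /dist_to_eq0 d0] := GB j; apply: ge_inf.
  by exists 0 => _ [h _ <-]; exact: sqr_ge0.
by exists i => //; rewrite d0 expr0n.
Qed.

Lemma sparse_min_error (R : realType) n m l k (G : 'I_m -> 'cV[R]_n) :
  sparse l k G -> min_error l k G = 0.
Proof.
move=> [B [Bk B0]]; apply/eqP; rewrite eq_le; apply/andP; split.
  apply: ge_inf; last by exists B.
  by exists 0 => _ [C _ <-]; exact: bundle_error_ge0.
apply: lb_le_inf => [|_ [C _ <-]]; last exact: bundle_error_ge0.
by exists 0; exists B.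
Qed.

(** A linear map does not raise dimensions, so the images of the subspaces form a bundle. *)
Lemma sparse_mulmx (R : realType) r N m l k (F : 'I_m -> 'cV[R]_N)
    (A : 'M[R]_(r, N)) : (0 < l)%N ->
  sparse l k F -> sparse l k (fun j => A *m F j).
Proof.
move=> l0 [B [Bk /(bundle_error_eq0 _ _ l0) FB]].
pose h : 'Hom('cV[R]_N, 'cV[R]_r) := linfun (mulmx A).
exists (fun i => (h @: B i)%VS); split.
  by move=> i; apply: leq_trans (Bk i); rewrite -(limg_ker_dim h (B i)) leq_addl.
apply/bundle_error_eq0 => // j; have [i FjB] := FB j; exists i.
by rewrite -[A *m F j](lfunE (mulmx A)) memv_img.
Qed.

(** The blocks cover all indices, so the spans have error 0; only their dimensions remain to be
    bounded. *)
Lemma optimal_span_bundle (R : realType) N m l k (F : 'I_m -> 'cV[R]_N)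
    (S : 'I_l -> {set 'I_m}) :
  (0 < l)%N -> sparse l k F -> is_partition S ->
  is_bundle k (span_bundle F S) -> optimal_bundle k F (span_bundle F S).
Proof.
move=> l0 spF [_ SU] Sk; split=> //; rewrite sparse_min_error//.
apply/bundle_error_eq0 => // j.
have /bigcupP[i _ jSi] : j \in (\bigcup_i S i)%SET by rewrite SU inE.
by exists i; apply/memv_span/mapP; exists j; rewrite ?mem_enum.
Qed.

(** Each [G j] is at distance 0 from some subspace of an optimal bundle, hence also from the one its
    block selects, which is nearest. *)
Lemma optimal_partition_sparse (R : realType) n m l k (G : 'I_m -> 'cV[R]_n)
    (S : 'I_l -> {set 'I_m}) :
  (0 < l)%N -> sparse l k G -> optimal_partition k G S ->
  exists2 B : 'I_l -> {vspace 'cV[R]_n}, is_bundle k B &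
    forall i j, j \in S i -> G j \in B i.
Proof.
move=> l0 spG [_ [B [Bk]]]; rewrite sparse_min_error// => /bundle_error_eq0.
move=> /(_ l0) GB gen; exists B => // i j jSi.
have [h /dist_to_eq0 d0] := GB j.
by apply/dist_to_eq0/eqP; rewrite eq_le dist_to_ge0 andbT -d0; exact: gen.
Qed.

Theorem proposition3p3 (R : realType) (N m r l k : nat)
    (F : 'I_m -> 'cV[R]_N) :
  (0 < N)%N -> (0 < m)%N -> (0 < r)%N -> (0 < l)%N -> (0 < k)%N ->
  (l < N)%N -> (k < N)%N ->
  sparse l k F ->
  (k < r)%N ->
  {ae lebesgue_mx R r N, forall A : 'M[R]_(r, N), admissible l k F A}.
Proof.
move=> _ _ _ l0 _ _ _ spF lt_kr.
pose U (S : {set 'I_m}) := <<[seq F j | j in S]>>%VS.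
have : {ae lebesgue_mx R r N, forall (A : 'M[R]_(r, N)) (S : {set 'I_m}),
    (k < \dim (U S))%N -> forall W : {vspace 'cV[R]_r},
    (forall u, u \in U S -> A *m u \in W) -> (k < \dim W)%N}.
  (* There are finitely many index sets, so their null sets have a null union. *)
  apply: filter_forall => S.
  have [lt_kU|_] := boolP (k < \dim (U S))%N; last exact: filterE.
  by apply: filterS (ae_dim_mulmx lt_kr lt_kU) => A.
apply: filterS => A genA S optS.
have [B Bk AFB] := optimal_partition_sparse l0 (sparse_mulmx A l0 spF) optS.
apply: optimal_span_bundle => //; first by case: optS.
(* If the span of a block had dimension above [k], so would [B i], which contains its image under
   [A]. *)
move=> i; rewrite leqNgt; apply/negP => /genA/(_ (B i)) lt_kB.
suff : (k < \dim (B i))%N by rewrite ltnNge Bk.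
apply: lt_kB => u.
pose h : 'Hom('cV[R]_N, 'cV[R]_r) := linfun (mulmx A).
have : (U (S i) <= h @^-1: B i)%VS.
  apply/span_subvP => v /mapP[j]; rewrite mem_enum => jSi ->.
  by rewrite -memv_preim lfunE; exact: AFB.
by move=> /subvP UB uU; have := UB u uU; rewrite -memv_preim lfunE.
Qed.
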